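(* Let $q\ge 41$ be an odd integer. Then the achromatic number of the Cartesian product $K_6\square K_q$ equals $2q+3$.
   Context: For a finite simple graph $G$ and a finite colour set $C$, a vertex colouring $f:V(G)\to C$ is complete if for any two distinct colours $c_1,c_2\in C$ there is an edge $v_1v_2\in E(G)$ with $f(v_i)=c_i$, $i=1,2$. The achromatic number of $G$ is the maximum number of colours in a proper complete vertex colouring of $G$. The Cartesian product $G_1\square G_2$ has vertex set $V(G_1)\times V(G_2)$, with $(u_1,u_2)$ adjacent to $(w_1,w_2)$ iff either $u_1w_1\in E(G_1)$ and $u_2=w_2$, or $u_2w_2\in E(G_2)$ and $u_1=w_1$. *)

(* Defs.v *)
From mathcomp Require Import all_boot.
Set Implicit Arguments. Unset Strict Implicit. Unset Printing Implicit Defensive.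

Definition simple_graph (T : finType) (e : rel T) : Prop :=
  symmetric e /\ irreflexive e.

Definition Kn (n : nat) : rel 'I_n := fun x y => x != y.
Arguments Kn n : clear implicits.

Definition cart_prod (T1 T2 : finType) (e1 : rel T1) (e2 : rel T2)
  : rel (T1 * T2) :=
  fun u w => (e1 u.1 w.1 && (u.2 == w.2)) || (e2 u.2 w.2 && (u.1 == w.1)).

Definition proper_col (T : finType) (e : rel T) (k : nat) (f : T -> 'I_k) : Prop :=
  forall x y, e x y -> f x != f y.

Definition complete_col (T : finType) (e : rel T) (k : nat) (f : T -> 'I_k) : Prop :=
  forall c1 c2 : 'I_k, c1 != c2 ->
    exists x y, [/\ e x y, f x = c1 & f y = c2].

Definition has_complete_coloring (T : finType) (e : rel T) (k : nat) : Prop :=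
  exists f : T -> 'I_k, proper_col e f /\ complete_col e f.

Definition achromatic_number_is (T : finType) (e : rel T) (n : nat) : Prop :=
  has_complete_coloring e n /\ forall k, has_complete_coloring e k -> k <= n.

(* Main.v *)
Require Import Defs.
From mathcomp Require Import all_boot zify.

(** Lower bound: the rows split into the pairs 01, 23, 45, and the row sets 024, 035, 125, 134 meet
pairwise, so colours living on these row sets see each other inside rows.  Equally many such
3-colours fill any even number of columns; a 6 x 7 block with 17 colours, each of which meets all
four row sets, completes the matrix.

Upper bound: let [R c] be the set of rows of a colour [c].  Every row meets [q] colours, and a colour
whose row set avoids [R c] must share one of the at most [#|R c|] columns of [c].  With at least
[2q + 4] colours on [6q] cells there are at least 12 colours of frequency 2, and at most 4 of them
have the same two rows.  If two of these pairs of rows meet in one row, the counting inequalities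
are contradictory by linear programming.  Otherwise the pairs form a perfect matching of the rows,
carrying 4 colours each; then all other colours are transversals of the matching, two complementary
transversals cannot both occur, and balancing the rows makes [q - 4] even. *)

(** * Lower bound *)

(* Found by computer search. *)
Definition gadget : seq (seq nat) :=
  [:: [:: 16; 7; 1; 13; 5; 3; 15];
      [:: 2; 6; 15; 10; 3; 5; 1];
      [:: 7; 2; 8; 16; 0; 9; 12];
      [:: 6; 13; 10; 0; 8; 12; 9];
      [:: 10; 16; 4; 6; 11; 7; 14];
      [:: 13; 9; 0; 2; 14; 4; 11]].

(* For each row, the row sets 0 = 024, 1 = 035, 2 = 125, 3 = 134 whose colours fill its first and its
second half. *)
Definition kinds : seq (seq nat) :=
  [:: [:: 0; 1]; [:: 2; 3]; [:: 2; 0]; [:: 1; 3]; [:: 0; 3]; [:: 2; 1]].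

Definition cell (i j : nat) : nat := nth 0 (nth [::] gadget i) j.

Definition kind (i b : nat) : nat := nth 0 (nth [::] kinds i) b.

(* Shifting row [i] cyclically by [i./2] separates the occurrences of a colour in its three rows:
no row set has two rows with the same shift. *)
Definition color (h i j : nat) : nat :=
  if j < 7 then cell i j
  else 17 + (kind i ((j - 7) %/ h) * h + ((j - 7) %% h + i./2) %% h).

(** Reads one instance off a finite check that [vm_compute] has run over a whole range of
    indices. *)
Lemma all_iotaP n (P : pred nat) i : all P (iota 0 n) -> i < n -> P i.
Proof. by move=> /allP allP lti; apply: allP; rewrite mem_iota. Qed.

Lemma slot_inj h t t' r r' : r < h -> r' < h -> t * h + r = t' * h + r' -> t = t' /\ r = r'.
Proof.
move=> ltr ltr' eq_s; have h0 : 0 < h by apply: leq_ltn_trans ltr.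
split; first by have := congr1 (divn^~ h) eq_s; rewrite !divnMDl // !divn_small // !addn0.
by have := congr1 (modn^~ h) eq_s; rewrite /= !modnMDl !modn_small.
Qed.

Lemma cell_lt i j : i < 6 -> j < 7 -> cell i j < 17.
Proof.
have : all (fun i => all (fun j => cell i j < 17) (iota 0 7)) (iota 0 6) by vm_compute.
by move=> H lti ltj; apply: (all_iotaP _ _ j (all_iotaP _ _ i H lti) ltj).
Qed.

Lemma kind_lt i b : i < 6 -> b < 2 -> kind i b < 4.
Proof.
have : all (fun i => all (fun b => kind i b < 4) (iota 0 2)) (iota 0 6) by vm_compute.
by move=> H lti ltb; apply: (all_iotaP _ _ b (all_iotaP _ _ i H lti) ltb).
Qed.

Lemma half_lt h j : 3 <= h -> j < 7 + 2 * h -> 7 <= j -> (j - 7) %/ h < 2.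
Proof. by move=> h_ge ltj lej; rewrite ltn_divLR; lia. Qed.

Lemma color_lt h i j : 3 <= h -> i < 6 -> j < 7 + 2 * h -> color h i j < 17 + 4 * h.
Proof.
move=> h_ge lti ltj; rewrite /color; case: (ltnP j 7) => [ltj7|lej].
  by have := cell_lt _ _ lti ltj7; lia.
have := kind_lt _ _ lti (half_lt _ _ h_ge ltj lej); set t := kind _ _ => lt_t.
have lt_r : ((j - 7) %% h + i./2) %% h < h by rewrite ltn_mod; lia.
by rewrite ltn_add2l; have : t * h <= 3 * h; [rewrite leq_mul2r; lia | lia].
Qed.

(** Gadget colours are below 17 and the others are not, so a clash needs two cells on the same side.
    The gadget is checked by computation. Outside it the kind gives the half, since the two kinds of
    a row differ, and the shift is a bijection modulo [h]. *)
Lemma color_row_inj h i j j' : 3 <= h -> i < 6 -> j < 7 + 2 * h -> j' < 7 + 2 * h ->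
  color h i j = color h i j' -> j = j'.
Proof.
move=> h_ge lti ltj ltj'; rewrite /color.
case: (ltnP j 7) => [ltj7|lej]; case: (ltnP j' 7) => [ltj7'|lej'].
- have : all (fun i => all (fun j => all (fun j' => (cell i j == cell i j') ==> (j == j'))
    (iota 0 7)) (iota 0 7)) (iota 0 6) by vm_compute.
  move=> H /eqP eq_c; apply/eqP; apply: implyP eq_c.
  exact: (all_iotaP _ _ _ (all_iotaP _ _ _ (all_iotaP _ _ _ H lti) ltj7) ltj7').
- by have := cell_lt _ _ lti ltj7; lia.
- by have := cell_lt _ _ lti ltj7'; lia.
move=> /addnI /slot_inj[]; rewrite ?ltn_mod; [lia | lia | move=> eq_k eq_r].
have eq_b : (j - 7) %/ h = (j' - 7) %/ h.
  have : all (fun i => all (fun b => all (fun b' => (kind i b == kind i b') ==> (b == b'))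
    (iota 0 2)) (iota 0 2)) (iota 0 6) by vm_compute.
  move=> H; apply/eqP; apply: implyP (introT eqP eq_k).
  exact: (all_iotaP _ _ _ (all_iotaP _ _ _ (all_iotaP _ _ _ H lti)
           (half_lt _ _ h_ge ltj lej)) (half_lt _ _ h_ge ltj' lej')).
have eq_m : (j - 7) %% h = (j' - 7) %% h.
  by move/eqP: eq_r; rewrite eqn_modDr !modn_mod => /eqP.
have : j - 7 = j' - 7 by rewrite (divn_eq (j - 7) h) eq_b eq_m -divn_eq.
by lia.
Qed.

(** Outside the gadget, equal colours in one column have the same kind and congruent shifts; kind,
    half and shift together determine the row. *)
Lemma color_col_inj h i i' j : 3 <= h -> i < 6 -> i' < 6 -> j < 7 + 2 * h ->
  color h i j = color h i' j -> i = i'.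
Proof.
move=> h_ge lti lti' ltj; rewrite /color; case: (ltnP j 7) => [ltj7|lej].
  have : all (fun i => all (fun i' => all (fun j => (cell i j == cell i' j) ==> (i == i'))
    (iota 0 7)) (iota 0 6)) (iota 0 6) by vm_compute.
  move=> H /eqP eq_c; apply/eqP; apply: implyP eq_c.
  exact: (all_iotaP _ _ _ (all_iotaP _ _ _ (all_iotaP _ _ _ H lti) lti') ltj7).
move=> /addnI /slot_inj[]; rewrite ?ltn_mod; [lia | lia | move=> eq_k /eqP].
(* Shifts are at most 2, so [3 <= h] turns the congruence into equality. *)
rewrite eqn_modDl !modn_small; [move=> /eqP eq_s | lia | lia].
have : all (fun i => all (fun i' => all (fun b => (kind i b == kind i' b) && (i./2 == i'./2)
  ==> (i == i')) (iota 0 2)) (iota 0 6)) (iota 0 6) by vm_compute.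
move=> H; apply/eqP; have := half_lt _ _ h_ge ltj lej.
move/(all_iotaP _ _ _ (all_iotaP _ _ _ (all_iotaP _ _ _ H lti) lti'))/implyP; apply.
by rewrite eq_k eq_s !eqxx.
Qed.

(** * Completeness of the block colouring *)

Lemma cell_occurs h i c : c \in nth [::] gadget i -> i < 6 ->
  exists2 j, j < 7 + 2 * h & color h i j = c.
Proof.
move=> ci lti; have size_i : size (nth [::] gadget i) = 7.
  have : all (fun i => size (nth [::] gadget i) == 7) (iota 0 6) by vm_compute.
  by move=> H; apply/eqP/(all_iotaP _ _ _ H lti).
have lt7 : index c (nth [::] gadget i) < 7 by rewrite -[X in _ < X]size_i index_mem.
exists (index c (nth [::] gadget i)); first by lia.
by rewrite /color lt7 /cell nth_index.
Qed.

Lemma kind_occurs h i t w : 3 <= h -> i < 6 -> w < h -> t \in nth [::] kinds i ->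
  exists2 j, j < 7 + 2 * h & color h i j = 17 + (t * h + w).
Proof.
move=> h_ge lti ltw ti; have size_i : size (nth [::] kinds i) = 2.
  have : all (fun i => size (nth [::] kinds i) == 2) (iota 0 6) by vm_compute.
  by move=> H; apply/eqP/(all_iotaP _ _ _ H lti).
(* [b] is the half of row [i] that carries kind [t], and [v] undoes the cyclic shift of that row;
   adding [h] keeps the subtraction from being truncated. *)
pose b := index t (nth [::] kinds i); have ltb : b < 2 by rewrite -[X in _ < X]size_i index_mem.
pose v := (w + h - i./2) %% h; have ltv : v < h by rewrite ltn_mod; lia.
exists (7 + (b * h + v)); first by have : b * h <= 1 * h; [rewrite leq_mul2r; lia | lia].
have -> : color h i (7 + (b * h + v)) =
    17 + (kind i ((b * h + v) %/ h) * h + ((b * h + v) %% h + i./2) %% h).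
  by rewrite /color ltnNge leq_addr /= addKn.
rewrite divnMDl ?modnMDl; last by lia.
rewrite (divn_small ltv) addn0 (modn_small ltv) /kind /b nth_index // /v modnDml.
by rewrite subnK ?modnDr ?modn_small //; lia.
Qed.

(** Stated over natural numbers to match the computed checks; the disjunction has the shape to which
    the edge relation of the product unfolds. *)
Definition adjacent_colors (h c1 c2 : nat) : Prop :=
  exists i1 j1 i2 j2, [/\ [&& i1 < 6, i2 < 6, j1 < 7 + 2 * h & j2 < 7 + 2 * h],
    (i1 != i2) && (j1 == j2) || (j1 != j2) && (i1 == i2),
    color h i1 j1 = c1 & color h i2 j2 = c2].

(** Any two of the four row sets meet, and every gadget colour occurs in a row of each of them, so
    only two gadget colours can need a common column. Those pairs are checked by computation. *)
Lemma color_complete h c1 c2 : 3 <= h -> c1 < 17 + 4 * h -> c2 < 17 + 4 * h -> c1 != c2 ->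
  adjacent_colors h c1 c2.
Proof.
move=> h_ge.
have same_row i d1 d2 : i < 6 -> d1 != d2 ->
    (exists2 j, j < 7 + 2 * h & color h i j = d1) ->
    (exists2 j, j < 7 + 2 * h & color h i j = d2) ->
  adjacent_colors h d1 d2.
  move=> lti neq [j1 lt1 eq1] [j2 lt2 eq2]; exists i, j1, i, j2; split=> //.
    by rewrite lti lt1 lt2.
  by rewrite !eqxx /= andbT; apply: contraNneq neq => eq_j; rewrite -eq1 -eq2 eq_j.
have sym d1 d2 : adjacent_colors h d1 d2 ->
  adjacent_colors h d2 d1.
  move=> [i1 [j1 [i2 [j2 [/and4P[a b c d] adj e1 e2]]]]]; exists i2, j2, i1, j1.
  by split; rewrite ?a ?b ?c ?d // (eq_sym i2) (eq_sym j2).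
have slot c : 17 <= c -> c < 17 + 4 * h ->
    exists2 t, t < 4 & exists2 w, w < h & c = 17 + (t * h + w).
  move=> ge lt; exists ((c - 17) %/ h); first by rewrite ltn_divLR; lia.
  exists ((c - 17) %% h); first by rewrite ltn_mod; lia.
  by rewrite -divn_eq; lia.
have mixed d1 d2 : d1 < 17 -> 17 <= d2 -> d2 < 17 + 4 * h -> d1 != d2 ->
  adjacent_colors h d1 d2.
  move=> lt1 ge2 lt2 neq; have [t lt_t [w lt_w eq2]] := slot _ ge2 lt2.
  have : all (fun c => all (fun t => has (fun i =>
    (c \in nth [::] gadget i) && (t \in nth [::] kinds i)) (iota 0 6)) (iota 0 4)) (iota 0 17).
    by vm_compute.
  move=> H; have /hasP[i] := all_iotaP _ _ _ (all_iotaP _ _ _ H lt1) lt_t.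
  rewrite mem_iota => /= lti /andP[ci ti]; apply: (same_row i) => //.
    exact: cell_occurs.
  by rewrite eq2; apply: kind_occurs.
move=> lt1 lt2 neq; case: (ltnP c1 17) => [lt1'|ge1]; case: (ltnP c2 17) => [lt2'|ge2].
- have : all (fun c => all (fun c' => (c == c') || has (fun i => has (fun j =>
    (cell i j == c) && has (fun i' => has (fun j' => (cell i' j' == c') &&
      ((i != i') && (j == j') || (j != j') && (i == i'))) (iota 0 7)) (iota 0 6))
    (iota 0 7)) (iota 0 6)) (iota 0 17)) (iota 0 17) by vm_compute.
  move=> H; have := all_iotaP _ _ _ (all_iotaP _ _ _ H lt1') lt2'.
  rewrite (negPf neq) => /hasP[i1 i1_lt /hasP[j1 j1_lt /andP[/eqP e1]]].
  case/hasP => i2 i2_lt /hasP[j2 j2_lt /andP[/eqP e2 adj]].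
  move: i1_lt j1_lt i2_lt j2_lt; rewrite !mem_iota => /= i1_lt j1_lt i2_lt j2_lt.
  exists i1, j1, i2, j2; rewrite /color j1_lt j2_lt; split=> //.
  by rewrite i1_lt i2_lt !ltn_addr.
- exact: mixed.
- by apply: sym; apply: mixed => //; rewrite eq_sym.
have [t lt_t [w lt_w eq1]] := slot _ ge1 lt1; have [t' lt_t' [w' lt_w' eq2]] := slot _ ge2 lt2.
have : all (fun t => all (fun t' => has (fun i =>
  (t \in nth [::] kinds i) && (t' \in nth [::] kinds i)) (iota 0 6)) (iota 0 4)) (iota 0 4).
  by vm_compute.
move=> H; have /hasP[i] := all_iotaP _ _ _ (all_iotaP _ _ _ H lt_t) lt_t'.
rewrite mem_iota => /= lti /andP[ti ti']; apply: (same_row i) => //.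
  by rewrite eq1; apply: kind_occurs.
by rewrite eq2; apply: kind_occurs.
Qed.

Lemma complete_coloring_exists q : 13 <= q -> odd q ->
  has_complete_coloring (cart_prod (Kn 6) (Kn q)) (2 * q + 3).
Proof.
(* Beside the 7 gadget columns there remain [2 * h] columns, an even number as [q] is odd; [13 <= q]
   gives [3 <= h]. *)
move=> q_ge q_odd; pose h := (q - 7)./2.
have h_ge : 3 <= h by rewrite /h; lia.
have eq_q : q = 7 + 2 * h by rewrite /h; lia.
have eq_k : 2 * q + 3 = 17 + 4 * h by lia.
have lt_q (j : 'I_q) : j < 7 + 2 * h by rewrite -eq_q.
have bound (x : 'I_6 * 'I_q) : color h x.1 x.2 < 2 * q + 3 by rewrite eq_k color_lt.
exists (fun x => Ordinal (bound x)); split=> [x y adj|c1 c2 neq].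
  apply/negP => /eqP/(congr1 val)/= eq_c; case/orP: adj => /andP[neq /eqP eq_xy].
    case/negP: neq; apply/eqP/val_inj; move: eq_c; rewrite eq_xy.
    exact: color_col_inj.
  case/negP: neq; apply/eqP/val_inj; move: eq_c; rewrite eq_xy.
  exact: color_row_inj.
have lt_k (c : 'I_(2 * q + 3)) : c < 17 + 4 * h by rewrite -eq_k.
have [i1 [j1 [i2 [j2 [/and4P[lti1 lti2 ltj1 ltj2] adj e1 e2]]]]] :=
  color_complete _ _ _ h_ge (lt_k c1) (lt_k c2) neq.
rewrite -eq_q in ltj1 ltj2.
exists (Ordinal lti1, Ordinal ltj1), (Ordinal lti2, Ordinal ltj2).
by split; [exact: adj | apply/val_inj | apply/val_inj].
Qed.

(** * Row sets of a complete colouring *)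

(** Lets counting bounds be obtained by summing pointwise inequalities between Booleans. *)
Lemma count_sum {C : finType} (P : pred C) : \sum_c (P c : nat) = #|[set c | P c]|.
Proof.
by rewrite -sum1_card [RHS]big_mkcond; apply: eq_bigr => c _; rewrite inE; case: (P c).
Qed.

Definition color_rows {q k : nat} (f : 'I_6 * 'I_q -> 'I_k) (c : 'I_k) : {set 'I_6} :=
  [set i | [exists j, f (i, j) == c]].

(** All that the upper bound uses of a colouring with too many colours. Columns survive only in the
    product bound of [profile_disjoint]: [c] has at most [#|R c|] columns, and each of them has
    [#|W|] cells in the rows [W]. *)
Record profile (q : nat) (C : finType) (R : C -> {set 'I_6}) : Prop := Profile {
  profile_size : 41 <= q;
  profile_card : 2 * q + 4 <= #|C|;
  profile_neq0 : forall c, R c != set0;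
  profile_row : forall i, #|[set c | i \in R c]| = q;
  profile_disjoint : forall c (W : {set 'I_6}), [disjoint R c & W] ->
    #|[set d | R d \subset W]| <= #|R c| * #|W| }.

Lemma color_rowsP {q k : nat} (f : 'I_6 * 'I_q -> 'I_k) x : x.1 \in color_rows f (f x).
Proof. by rewrite inE; apply/existsP; exists x.2; case: x. Qed.

(* A colour avoiding the rows of [c] is seen from [c] only inside the columns of [c]. *)
Lemma coloring_profile {q k : nat} (f : 'I_6 * 'I_q -> 'I_k) :
  41 <= q -> 2 * q + 4 <= k -> proper_col (cart_prod (Kn 6) (Kn q)) f ->
  complete_col (cart_prod (Kn 6) (Kn q)) f -> profile q _ (color_rows f).
Proof.
move=> q_ge k_ge fP fC.
have k_gt1 : 1 < k by lia.
have row_inj i : injective (fun j => f (i, j)).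
  move=> j1 j2 /eqP eq_f; apply: contraTeq eq_f => neq_j.
  by apply: fP; rewrite /cart_prod /Kn /= neq_j eqxx orbT.
have neq0 c : color_rows f c != set0.
  (* Completeness produces a cell of colour [c] only against a second colour, which exists since
     [k > 1]. *)
  have [d neq_cd] : exists d : 'I_k, c != d.
    have [eq_c0|neq_c0] := eqVneq c (Ordinal (ltnW k_gt1)).
      by exists (Ordinal k_gt1); rewrite eq_c0.
    by exists (Ordinal (ltnW k_gt1)).
  have [x [y [_ <- _]]] := fC _ _ neq_cd.
  by apply/set0Pn; exists x.1; apply: color_rowsP.
split=> // [|i|c W disjRW]; first by rewrite card_ord.
  rewrite -[RHS]card_ord -(card_codom (row_inj i)); apply: eq_card => c.
  rewrite !inE; apply/existsP/codomP => [[j /eqP <-]|[j ->]]; first by exists j.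
  by exists j.
pose X := [set x | f x == c].
(* A row is a clique, so a colour has at most one cell in each row and hence at most [#|R c|]
   cells. *)
have injX : {in X &, injective fst}.
  move=> x y; case: x => i1 j1; case: y => i2 j2; rewrite !inE /=.
  by move=> /eqP f1 /eqP f2 eq_i; move: f2; rewrite -f1 -eq_i => /row_inj ->.
have cardX : #|X| <= #|color_rows f c|.
  rewrite -(card_in_imset injX); apply/subset_leq_card/subsetP => _ /imsetP[x + ->]; rewrite inE => /eqP <-.
  exact: color_rowsP.
have sub : [set d | color_rows f d \subset W] \subset f @: setX W (snd @: X).
  apply/subsetP => d; rewrite inE => /subsetP sdW.
  have neq_cd : c != d.
    have /set0Pn[i ci] := neq0 c; apply: contraTneq (ci) => eq_cd.
    by rewrite (disjointFl disjRW) // sdW -?eq_cd.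
  have [x [y [adj fx fy]]] := fC _ _ neq_cd.
  have Wy : y.1 \in W by apply: sdW; rewrite -fy color_rowsP.
  apply/imsetP; exists y => //; case: y fy Wy adj => i j fy Wi.
  rewrite in_setX Wi /= => adj; apply/imsetP; exists x; first by rewrite inE fx.
  (* A common row would belong both to [c] and to [W], so [x] and [y] share a column. *)
  move: adj; rewrite /cart_prod => /orP[|]/andP[_ /eqP] //= eq_i.
  by have := color_rowsP f x; rewrite fx eq_i (disjointFl disjRW).
apply: leq_trans (subset_leq_card sub) _; apply: leq_trans (leq_imset_card _ _) _.
rewrite cardsX mulnC leq_mul2r; apply/orP; right.
exact: leq_trans (leq_imset_card _ _) cardX.
Qed.

(** If [c] lived in the single row [i], at most 5 colours could avoid that row, but at least [q + 4]
    do. *)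
Lemma profile_gt1 {q : nat} {C : finType} {R : C -> {set 'I_6}} c :
  profile q C R -> 1 < #|R c|.
Proof.
move=> RP; have leC := profile_card _ _ _ RP; have q_ge := profile_size _ _ _ RP.
rewrite ltnNge; apply/negP => leR.
have /cards1P[i Rc] : #|R c| == 1 by rewrite eqn_leq leR card_gt0 (profile_neq0 _ _ _ RP).
have disj : [disjoint R c & ~: [set i]] by rewrite Rc -setI_eq0 setICr.
have := profile_disjoint _ _ _ RP _ _ disj.
have -> : [set d | R d \subset ~: [set i]] = ~: [set d | i \in R d].
  by apply/setP => d; rewrite !inE subsetC sub1set inE.
rewrite [X in X <= _]cardsCs setCK (profile_row _ _ _ RP) Rc cards1 mul1n.
by rewrite [X in _ <= X]cardsCs setCK cards1 card_ord; lia.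
Qed.

(** At most 8 colours avoid both rows. Every other colour uses one of the rows, and a colour with
    exactly these rows is counted in both, so [#|C| + n <= 2 * q + 8], where [n] is the number of
    such colours. *)
Lemma profile_pair {q : nat} {C : finType} {R : C -> {set 'I_6}} c :
  profile q C R -> #|R c| = 2 -> #|[set d | R d == R c]| <= 4.
Proof.
move=> RP /eqP/cards2P[i [j [neq_ij Rc]]]; have leC := profile_card _ _ _ RP.
have disj : [disjoint R c & ~: R c] by rewrite -setI_eq0 setICr.
have := profile_disjoint _ _ _ RP _ _ disj.
rewrite [X in _ * X]cardsCs setCK card_ord Rc cards2 neq_ij /= => le8.
have: \sum_d (1 + (R d == [set i; j])) <=
      \sum_d ((i \in R d) + (j \in R d) + (R d \subset ~: [set i; j])).
  apply: leq_sum => d _.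
  have -> : (R d \subset ~: [set i; j]) = (i \notin R d) && (j \notin R d).
    by rewrite subsetC subUset !sub1set !inE.
  case: eqP => [->|_]; first by rewrite !inE !eqxx orbT.
  by case: (i \in _); case: (j \in _).
have cardC : \sum_(d : C) 1 = #|C| by rewrite sum1_card.
by rewrite !big_split /= !count_sum cardC !(profile_row _ _ _ RP) -Rc in le8 *; lia.
Qed.

(** * Linear certificates *)

(* The pattern of a colour is the increasing list of its row indices, relative to a labelling of the
rows.  A form [(w, u, v)] stands for the sum of [w] over the patterns of all colours, plus
[u * q + v], and each inequality reads [lhs <= rhs].  [Occ s] states that the pattern [s] occurs,
[Within s W] bounds the colours inside [W] when some pattern [s] avoids [W], and [Lo s], [Hi s]
are the two cases of [2 * n + 4 != q], where [n] counts the colours with pattern [s]. *)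
Inductive ineq : Type :=
| RowLe of nat
| RowGe of nat
| Total
| Size
| Cap of seq nat
| Within of seq nat & seq nat
| Occ of seq nat
| Lo of seq nat
| Hi of seq nat.

Definition form : Type := (seq nat -> nat) * nat * nat.

Definition lhs (a : ineq) : form :=
  match a with
  | RowLe i => (fun T => (i \in T : nat), 0, 0)
  | RowGe _ => (fun=> 0, 1, 0)
  | Total => (fun=> 0, 2, 4)
  | Size => (fun=> 0, 0, 41)
  | Cap e => (fun T => (T == e : nat), 0, 0)
  | Within _ W => (fun T => (all (mem W) T : nat), 0, 0)
  | Occ _ => (fun=> 0, 0, 1)
  | Lo s => (fun T => 2 * (T == s), 0, 5)
  | Hi _ => (fun=> 0, 1, 0)
  end.

Definition rhs (a : ineq) : form :=
  match a with
  | RowLe _ => (fun=> 0, 1, 0)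
  | RowGe i => (fun T => (i \in T : nat), 0, 0)
  | Total => (fun=> 1, 0, 0)
  | Size => (fun=> 0, 1, 0)
  | Cap _ => (fun=> 0, 0, 4)
  | Within s W => (fun=> 0, 0, size s * size W)
  | Occ s => (fun T => (T == s : nat), 0, 0)
  | Lo _ => (fun=> 0, 1, 0)
  | Hi s => (fun T => 2 * (T == s), 0, 3)
  end.

Fixpoint combine (side : ineq -> form) (cert : seq (nat * ineq)) : form :=
  if cert is (m, a) :: cert' then
    let: (w, u, v) := side a in
    let: (w', u', v') := combine side cert' in
    (fun T => m * w T + w' T, m * u + u', m * v + v')
  else (fun=> 0, 0, 0).

Fixpoint subseqs (s : seq nat) : seq (seq nat) :=
  if s is x :: s' then map (cons x) (subseqs s') ++ subseqs s' else [:: [::]].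

(** Shorter patterns are left out because every colour occupies at least two rows. *)
Definition patterns : seq (seq nat) := [seq T <- subseqs (iota 0 6) | 1 < size T].
Arguments patterns : simpl never.

(** The combined left side dominates the right one on every pattern not known to be absent and in
    the coefficient of [q], and strictly in the constant, whereas a combination of valid
    inequalities gives the opposite comparison. *)
Definition contradictory (zero : seq (seq nat)) (cert : seq (nat * ineq)) : bool :=
  let: (w, u, v) := combine lhs cert in
  let: (w', u', v') := combine rhs cert in
  [&& all (fun T => w' T <= w T) [seq T <- patterns | T \notin zero],
      u' <= u & v' < v].

Definition available (occ lo hi : seq (seq nat)) (a : ineq) : bool :=
  match a with
  | RowLe i | RowGe i => i < 6
  | Total | Size => true
  | Cap e => size e == 2
  | Within s W => [&& s \in occ, all (gtn 6) W & ~~ has (mem s) W]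
  | Occ s => s \in occ
  | Lo s => s \in lo
  | Hi s => s \in hi
  end.

(* [Split s] distinguishes whether the pattern [s] occurs, [Parity s] uses that [q] is odd. *)
Inductive refutation : Type :=
| Leaf of seq (nat * ineq)
| Split of seq nat & refutation & refutation
| Parity of seq nat & refutation & refutation.

(** [occ] and [zero] collect the patterns assumed present and absent on the current branch, [lo] and
    [hi] those on either side of a parity case. *)
Fixpoint refutes (t : refutation) (occ zero lo hi : seq (seq nat)) : bool :=
  match t with
  | Leaf cert => all (fun ma => available occ lo hi ma.2) cert && contradictory zero cert
  | Split s t1 t2 => refutes t1 (s :: occ) zero lo hi && refutes t2 occ (s :: zero) lo hi
  | Parity s t1 t2 => refutes t1 occ zero (s :: lo) hi && refutes t2 occ zero lo (s :: hi)
  end.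

(* The multipliers at the leaves are Farkas certificates found by an external linear program solver. *)
Definition cherry_refutation : refutation :=
Split [:: 0; 4]
 (Split [:: 1; 2; 4]
  (Leaf [:: (2, RowLe 0); (1, RowLe 1); (1, RowLe 2); (1, RowLe 4); (3, Total); (1, Size);
    (1, Within [:: 0; 1] [:: 2; 3; 4; 5]); (1, Within [:: 0; 2] [:: 1; 3; 4; 5]);
    (1, Within [:: 0; 4] [:: 1; 2; 3; 5]); (1, Within [:: 1; 2; 4] [:: 0; 3; 5])])
  (Leaf [:: (2, RowLe 0); (1, RowLe 1); (1, RowLe 2); (1, RowLe 3); (1, RowLe 4); (1, RowLe 5);
    (4, Total); (1, Size); (1, Cap [:: 0; 1]); (1, Cap [:: 0; 2]); (1, Cap [:: 0; 3]);
    (1, Cap [:: 0; 4]); (1, Cap [:: 0; 5]); (1, Cap [:: 1; 2]); (1, Cap [:: 1; 4]);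
    (1, Within [:: 0; 1] [:: 2; 3; 4]); (1, Within [:: 0; 1] [:: 2; 4; 5]);
    (1, Within [:: 0; 2] [:: 1; 3; 4; 5]); (1, Within [:: 0; 4] [:: 1; 2; 3; 5])]))
 (Split [:: 0; 4; 5]
  (Split [:: 1; 2]
   (Leaf [:: (1, RowLe 0); (1, RowLe 1); (1, RowLe 2); (2, Total); (1, Size);
     (1, Within [:: 0; 1] [:: 2; 3; 4; 5]); (1, Within [:: 0; 2] [:: 1; 3; 4; 5]);
     (1, Within [:: 1; 2] [:: 0; 3; 4; 5])])
   (Split [:: 0; 3]
    (Leaf [:: (2, RowLe 0); (1, RowLe 1); (1, RowLe 2); (1, RowLe 3); (1, RowLe 4); (1, RowLe 5);
      (4, Total); (1, Size); (1, Cap [:: 0; 1]); (1, Cap [:: 0; 2]); (1, Cap [:: 0; 3]);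
      (1, Cap [:: 0; 5]); (1, Within [:: 0; 1] [:: 2; 3; 4; 5]); (1, Within [:: 0; 2] [:: 1; 3; 4; 5]);
      (1, Within [:: 0; 4; 5] [:: 1; 2; 3]); (1, Within [:: 0; 3] [:: 1; 2; 4; 5])])
    (Split [:: 4; 5]
     (Split [:: 1; 4]
      (Split [:: 0; 3; 4]
       (Leaf [:: (2, RowLe 0); (2, RowLe 1); (1, RowLe 2); (1, RowLe 3); (2, RowLe 4); (1, RowLe 5);
         (5, Total); (1, Size); (1, Cap [:: 0; 5]); (1, Cap [:: 2; 4]);
         (1, Within [:: 0; 1] [:: 2; 3; 4; 5]); (1, Within [:: 0; 2] [:: 1; 3; 4; 5]);
         (1, Within [:: 4; 5] [:: 0; 1; 2; 3]); (1, Within [:: 1; 4] [:: 0; 2; 3; 5]);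
         (1, Within [:: 0; 3; 4] [:: 1; 2; 5])])
       (Leaf [:: (1, RowLe 0); (1, RowLe 1); (1, RowLe 2); (1, RowLe 4); (1, RowLe 5); (3, Total);
         (1, Size); (1, Within [:: 0; 1] [:: 2; 3; 4; 5]); (1, Within [:: 0; 2] [:: 1; 3; 4; 5]);
         (1, Within [:: 4; 5] [:: 0; 1; 2; 3]); (1, Within [:: 1; 4] [:: 0; 3; 5])]))
      (Split [:: 1; 2; 5]
       (Split [:: 1; 2; 4]
        (Leaf [:: (1, RowLe 0); (1, RowLe 1); (1, RowLe 2); (1, RowLe 4); (1, RowLe 5); (3, Total);
          (1, Size); (1, Within [:: 0; 1] [:: 2; 3; 4; 5]); (1, Within [:: 0; 2] [:: 1; 3; 4; 5]);
          (1, Occ [:: 4; 5]); (1, Within [:: 4; 5] [:: 0; 1; 2; 3]);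
          (1, Within [:: 1; 2; 5] [:: 0; 3; 4]); (1, Within [:: 1; 2; 4] [:: 0; 3; 5])])
        (Leaf [:: (3, RowLe 0); (2, RowLe 1); (2, RowLe 2); (1, RowLe 3); (1, RowLe 4);
          (2, RowLe 5); (6, Total); (1, Size); (1, Cap [:: 0; 5]); (1, Within [:: 0; 1] [:: 2; 3; 4]);
          (1, Within [:: 0; 1] [:: 2; 4; 5]); (1, Within [:: 0; 1] [:: 2; 3; 4; 5]);
          (2, Within [:: 0; 2] [:: 1; 3; 4; 5]); (1, Occ [:: 4; 5]);
          (1, Within [:: 4; 5] [:: 0; 1; 2; 3]); (1, Within [:: 1; 2; 5] [:: 0; 3; 4])]))
       (Split [:: 1; 2; 4]
        (Leaf [:: (3, RowLe 0); (2, RowLe 1); (2, RowLe 2); (1, RowLe 3); (2, RowLe 4);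
          (1, RowLe 5); (6, Total); (1, Size); (1, Cap [:: 0; 5]); (1, Cap [:: 1; 5]);
          (1, Cap [:: 2; 5]); (2, Within [:: 0; 1] [:: 2; 3; 4; 5]); (1, Within [:: 0; 2] [:: 1; 3; 5]);
          (1, Within [:: 0; 2] [:: 1; 3; 4; 5]); (1, Within [:: 4; 5] [:: 0; 1; 2; 3]);
          (1, Within [:: 1; 2; 4] [:: 0; 3; 5])])
        (Leaf [:: (2, RowLe 0); (1, RowLe 1); (1, RowLe 2); (1, RowLe 3); (1, RowLe 4);
          (1, RowLe 5); (4, Total); (1, Size); (1, Cap [:: 0; 5]); (1, Cap [:: 1; 5]);
          (1, Within [:: 0; 1] [:: 2; 4; 5]); (1, Within [:: 0; 1] [:: 2; 3; 4; 5]);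
          (1, Within [:: 0; 2] [:: 1; 3; 4; 5]); (1, Within [:: 4; 5] [:: 0; 1; 2; 3])]))))
     (Split [:: 3; 5]
      (Split [:: 0; 3; 4]
       (Leaf [:: (2, RowLe 0); (1, RowLe 1); (1, RowLe 2); (1, RowLe 3); (1, RowLe 4); (1, RowLe 5);
         (4, Total); (1, Size); (1, Cap [:: 0; 5]); (1, Within [:: 0; 1] [:: 2; 3; 4; 5]);
         (1, Within [:: 0; 2] [:: 1; 3; 4; 5]); (1, Within [:: 0; 4; 5] [:: 1; 2; 3]);
         (1, Within [:: 3; 5] [:: 0; 1; 2; 4]); (1, Within [:: 0; 3; 4] [:: 1; 2; 5])])
       (Leaf [:: (3, RowLe 0); (2, RowLe 1); (2, RowLe 2); (1, RowLe 3); (1, RowLe 4); (2, RowLe 5);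
         (6, Total); (1, Size); (1, Cap [:: 0; 5]); (2, Within [:: 0; 1] [:: 2; 3; 4; 5]);
         (2, Within [:: 0; 2] [:: 1; 3; 4; 5]); (1, Within [:: 0; 4; 5] [:: 1; 2; 3]); (1, Occ [:: 3; 5]);
         (1, Within [:: 3; 5] [:: 0; 1; 2; 4])]))
      (Split [:: 0; 3; 4]
       (Split [:: 0; 3; 5]
        (Leaf [:: (2, RowLe 0); (1, RowLe 1); (1, RowLe 2); (1, RowLe 3); (1, RowLe 4);
          (1, RowLe 5); (4, Total); (1, Size); (1, Cap [:: 0; 1]); (1, Cap [:: 0; 2]);
          (1, Cap [:: 0; 5]); (1, Within [:: 0; 1] [:: 2; 3; 4; 5]);
          (1, Within [:: 0; 2] [:: 1; 3; 4; 5]); (1, Within [:: 0; 4; 5] [:: 1; 2; 3]);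
          (1, Within [:: 0; 3; 4] [:: 1; 2; 5]); (1, Within [:: 0; 3; 5] [:: 1; 2; 4])])
        (Split [:: 1; 4]
         (Leaf [:: (2, RowLe 0); (2, RowLe 1); (1, RowLe 2); (1, RowLe 3); (2, RowLe 4);
           (1, RowLe 5); (5, Total); (1, Size); (1, Cap [:: 0; 1]); (1, Cap [:: 2; 4]);
           (1, Within [:: 0; 1] [:: 2; 3; 4; 5]); (1, Within [:: 0; 2] [:: 1; 3; 4; 5]);
           (1, Within [:: 0; 4; 5] [:: 1; 2; 3]); (1, Within [:: 0; 3; 4] [:: 1; 2; 5]);
           (1, Within [:: 1; 4] [:: 0; 2; 5]); (1, Within [:: 1; 4] [:: 0; 2; 3; 5])])
         (Leaf [:: (3, RowLe 0); (2, RowLe 1); (2, RowLe 2); (1, RowLe 3); (2, RowLe 4);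
           (1, RowLe 5); (6, Total); (1, Size); (1, Cap [:: 0; 1]); (1, Cap [:: 0; 2]);
           (2, Cap [:: 0; 5]); (2, Within [:: 0; 1] [:: 2; 3; 4; 5]); (1, Within [:: 0; 2] [:: 1; 3; 5]);
           (1, Within [:: 0; 2] [:: 1; 3; 4; 5]); (1, Within [:: 0; 4; 5] [:: 1; 2; 3]);
           (1, Within [:: 0; 3; 4] [:: 1; 2; 5])])))
       (Split [:: 1; 2; 4]
        (Leaf [:: (3, RowLe 0); (2, RowLe 1); (2, RowLe 2); (1, RowLe 4); (1, RowLe 5); (5, Total);
          (1, Size); (2, Within [:: 0; 1] [:: 2; 3; 4; 5]); (2, Within [:: 0; 2] [:: 1; 3; 4; 5]);
          (1, Within [:: 0; 4; 5] [:: 1; 2; 3]); (1, Within [:: 1; 2; 4] [:: 0; 3; 5])])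
        (Leaf [:: (3, RowLe 0); (2, RowLe 1); (2, RowLe 2); (1, RowLe 3); (1, RowLe 4);
          (2, RowLe 5); (6, Total); (1, Size); (1, Cap [:: 0; 1]); (1, Cap [:: 0; 2]);
          (1, Cap [:: 0; 5]); (1, Within [:: 0; 1] [:: 2; 3; 4]); (1, Within [:: 0; 1] [:: 2; 4; 5]);
          (1, Within [:: 0; 1] [:: 2; 3; 4; 5]); (1, Within [:: 0; 2] [:: 1; 3; 4]);
          (1, Within [:: 0; 2] [:: 1; 4; 5]); (1, Within [:: 0; 2] [:: 1; 3; 4; 5]);
          (1, Within [:: 0; 4; 5] [:: 1; 2; 3])])))))))
  (Split [:: 0; 3]
   (Leaf [:: (2, RowLe 0); (1, RowLe 1); (1, RowLe 2); (1, RowLe 3); (3, Total); (1, Size);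
     (1, Cap [:: 0; 5]); (1, Within [:: 0; 1] [:: 2; 3; 4; 5]); (1, Within [:: 0; 2] [:: 1; 3; 4; 5]);
     (1, Within [:: 0; 3] [:: 1; 2; 4; 5])])
   (Split [:: 1; 2]
    (Leaf [:: (1, RowLe 0); (1, RowLe 1); (1, RowLe 2); (2, Total); (1, Size);
      (1, Within [:: 0; 1] [:: 2; 3; 4; 5]); (1, Within [:: 0; 2] [:: 1; 3; 4; 5]);
      (1, Within [:: 1; 2] [:: 0; 3; 4; 5])])
    (Split [:: 1; 2; 4]
     (Split [:: 0; 3; 4]
      (Leaf [:: (3, RowLe 0); (2, RowLe 1); (2, RowLe 2); (1, RowLe 3); (1, RowLe 4); (5, Total);
        (1, Size); (1, Cap [:: 0; 5]); (2, Within [:: 0; 1] [:: 2; 3; 4; 5]);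
        (2, Within [:: 0; 2] [:: 1; 3; 4; 5]); (1, Within [:: 1; 2; 4] [:: 0; 3; 5]);
        (1, Within [:: 0; 3; 4] [:: 1; 2; 5])])
      (Leaf [:: (2, RowLe 0); (2, RowLe 1); (2, RowLe 2); (1, RowLe 3); (1, RowLe 4); (1, RowLe 5);
        (5, Total); (1, Size); (1, Cap [:: 0; 1]); (1, Cap [:: 0; 2]); (1, Cap [:: 0; 5]);
        (2, Within [:: 0; 1] [:: 2; 3; 4; 5]); (2, Within [:: 0; 2] [:: 1; 3; 4; 5]);
        (1, Within [:: 1; 2; 4] [:: 0; 3; 5])]))
     (Split [:: 1; 2; 5]
      (Leaf [:: (3, RowLe 0); (2, RowLe 1); (2, RowLe 2); (1, RowLe 3); (1, RowLe 5); (5, Total);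
        (1, Size); (1, Cap [:: 0; 5]); (1, Cap [:: 1; 4]); (1, Cap [:: 2; 4]);
        (2, Within [:: 0; 1] [:: 2; 3; 4; 5]); (2, Within [:: 0; 2] [:: 1; 3; 4; 5]);
        (1, Within [:: 1; 2; 5] [:: 0; 3; 4])])
      (Leaf [:: (3, RowLe 0); (2, RowLe 1); (2, RowLe 2); (2, RowLe 3); (1, RowLe 4); (1, RowLe 5);
        (6, Total); (1, Size); (1, Cap [:: 0; 1]); (1, Cap [:: 0; 2]); (2, Cap [:: 0; 5]);
        (1, Within [:: 0; 1] [:: 2; 4; 5]); (2, Within [:: 0; 1] [:: 2; 3; 4; 5]);
        (1, Within [:: 0; 2] [:: 1; 4; 5]); (2, Within [:: 0; 2] [:: 1; 3; 4; 5])])))))).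

Definition matching_edges : seq (seq nat) := [:: [:: 0; 1]; [:: 2; 3]; [:: 4; 5]].

(** Assumed absent in the matching case, where every colour with two rows sits on an edge of the
    matching. *)
Definition other_edges : seq (seq nat) :=
  [seq T <- patterns | (size T == 2) && (T \notin matching_edges)].

(** Splits on the transversals of the matching. At both [Parity] nodes one transversal of each
    complementary pair is still possible, and these four meet pairwise, as in the lower bound; the
    two leaves then leave only [2 * n + 4 = q]. *)
Definition matching_refutation : refutation :=
Split [:: 0; 2; 5]
 (Split [:: 1; 2; 4]
  (Split [:: 0; 2; 4]
   (Split [:: 1; 2; 5]
    (Leaf [:: (1, RowLe 0); (1, RowLe 1); (1, RowLe 2); (1, RowLe 4); (1, RowLe 5); (3, Total);
      (1, Size); (1, Within [:: 0; 1] [:: 2; 3; 4; 5]); (1, Within [:: 4; 5] [:: 0; 1; 2; 3]);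
      (1, Within [:: 0; 2; 5] [:: 1; 3; 4]); (1, Within [:: 1; 2; 4] [:: 0; 3; 5]);
      (1, Within [:: 0; 2; 4] [:: 1; 3; 5]); (1, Within [:: 1; 2; 5] [:: 0; 3; 4])])
    (Leaf [:: (2, RowLe 0); (1, RowLe 1); (2, RowLe 2); (1, RowLe 3); (2, RowLe 4); (1, RowLe 5);
      (5, Total); (1, Size); (1, Within [:: 0; 1] [:: 2; 3; 4; 5]); (1, Within [:: 2; 3] [:: 0; 1; 4; 5]);
      (1, Within [:: 4; 5] [:: 0; 1; 2; 3]); (1, Within [:: 0; 2; 5] [:: 1; 3; 4]);
      (1, Within [:: 1; 2; 4] [:: 0; 3; 5]); (1, Occ [:: 0; 2; 4]);
      (2, Within [:: 0; 2; 4] [:: 1; 3; 5])]))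
   (Split [:: 1; 3; 4]
    (Split [:: 0; 3; 4]
     (Leaf [:: (1, RowLe 0); (2, RowLe 1); (1, RowLe 2); (2, RowLe 3); (2, RowLe 4); (1, RowLe 5);
       (5, Total); (1, Size); (1, Within [:: 0; 1] [:: 2; 3; 4; 5]);
       (1, Within [:: 2; 3] [:: 0; 1; 4; 5]); (1, Within [:: 4; 5] [:: 0; 1; 2; 3]);
       (1, Within [:: 1; 2; 4] [:: 0; 3; 5]); (1, Occ [:: 1; 3; 4]);
       (2, Within [:: 1; 3; 4] [:: 0; 2; 5]); (1, Within [:: 0; 3; 4] [:: 1; 2; 5])])
     (Leaf [:: (1, RowLe 1); (1, RowLe 2); (1, RowLe 3); (1, RowLe 4); (1, RowLe 5); (3, Total);
       (1, Size); (1, Within [:: 2; 3] [:: 0; 1; 4; 5]); (1, Within [:: 4; 5] [:: 0; 1; 2; 3]);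
       (1, Within [:: 1; 2; 4] [:: 0; 3; 5]); (1, Within [:: 1; 3; 4] [:: 0; 2; 5])]))
    (Split [:: 1; 2; 5]
     (Leaf [:: (1, RowLe 0); (2, RowLe 1); (2, RowLe 2); (1, RowLe 3); (1, RowLe 4); (2, RowLe 5);
       (5, Total); (1, Size); (1, Within [:: 0; 1] [:: 2; 3; 4; 5]);
       (1, Within [:: 2; 3] [:: 0; 1; 4; 5]); (1, Within [:: 4; 5] [:: 0; 1; 2; 3]);
       (1, Within [:: 1; 2; 4] [:: 0; 3; 5]); (1, Occ [:: 1; 2; 5]);
       (2, Within [:: 1; 2; 5] [:: 0; 3; 4])])
     (Split [:: 0; 3; 5]
      (Leaf [:: (2, RowLe 0); (1, RowLe 1); (1, RowLe 2); (2, RowLe 3); (1, RowLe 4); (2, RowLe 5);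
        (5, Total); (1, Size); (1, Within [:: 0; 1] [:: 2; 3; 4; 5]);
        (1, Within [:: 2; 3] [:: 0; 1; 4; 5]); (1, Within [:: 4; 5] [:: 0; 1; 2; 3]);
        (1, Occ [:: 0; 3; 5]); (2, Within [:: 0; 3; 5] [:: 1; 2; 4])])
      (Parity [:: 1; 2; 4]
       (Leaf [:: (2, RowLe 0); (1, RowLe 1); (1, RowLe 2); (2, RowLe 3); (1, RowLe 4); (2, RowLe 5);
         (5, Total); (1, Within [:: 0; 1] [:: 2; 3; 4; 5]); (1, Within [:: 2; 3] [:: 0; 1; 4; 5]);
         (1, Within [:: 4; 5] [:: 0; 1; 2; 3]); (1, Lo [:: 1; 2; 4])])
       (Leaf [:: (1, RowLe 1); (1, RowLe 2); (1, RowLe 4); (1, Total); (1, Hi [:: 1; 2; 4])]))))))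
  (Split [:: 0; 3; 4]
   (Split [:: 0; 2; 4]
    (Leaf [:: (1, RowLe 0); (1, RowLe 2); (1, RowLe 3); (1, RowLe 4); (1, RowLe 5); (3, Total);
      (1, Size); (1, Within [:: 2; 3] [:: 0; 1; 4; 5]); (1, Within [:: 4; 5] [:: 0; 1; 2; 3]);
      (1, Within [:: 0; 2; 5] [:: 1; 3; 4]); (1, Within [:: 0; 3; 4] [:: 1; 2; 5]);
      (1, Within [:: 0; 2; 4] [:: 1; 3; 5])])
    (Leaf [:: (2, RowLe 0); (1, RowLe 1); (1, RowLe 2); (2, RowLe 3); (1, RowLe 4); (2, RowLe 5);
      (5, Total); (1, Size); (1, Within [:: 0; 1] [:: 2; 3; 4; 5]); (1, Within [:: 2; 3] [:: 0; 1; 4; 5]);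
      (1, Within [:: 4; 5] [:: 0; 1; 2; 3]); (1, Within [:: 0; 2; 5] [:: 1; 3; 4]);
      (1, Within [:: 0; 3; 4] [:: 1; 2; 5])]))
   (Split [:: 0; 2; 4]
    (Leaf [:: (2, RowLe 0); (1, RowLe 1); (2, RowLe 2); (1, RowLe 3); (1, RowLe 4); (2, RowLe 5);
      (5, Total); (1, Size); (1, Within [:: 0; 1] [:: 2; 3; 4; 5]); (1, Within [:: 2; 3] [:: 0; 1; 4; 5]);
      (1, Within [:: 4; 5] [:: 0; 1; 2; 3]); (1, Occ [:: 0; 2; 5]); (2, Within [:: 0; 2; 5] [:: 1; 3; 4]);
      (1, Within [:: 0; 2; 4] [:: 1; 3; 5])])
    (Leaf [:: (1, RowLe 0); (1, RowLe 1); (1, RowLe 2); (1, RowLe 3); (1, RowLe 5); (3, Total);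
      (1, Size); (1, Within [:: 0; 1] [:: 2; 3; 4; 5]); (1, Within [:: 2; 3] [:: 0; 1; 4; 5]);
      (1, Within [:: 0; 2; 5] [:: 1; 3; 4])]))))
 (Split [:: 0; 3; 5]
  (Split [:: 1; 2; 4]
   (Split [:: 0; 3; 4]
    (Split [:: 0; 2; 4]
     (Leaf [:: (1, RowLe 0); (1, RowLe 1); (1, RowLe 2); (1, RowLe 3); (1, RowLe 4); (3, Total);
       (1, Size); (1, Within [:: 0; 1] [:: 2; 3; 4; 5]); (1, Within [:: 2; 3] [:: 0; 1; 4; 5]);
       (1, Within [:: 1; 2; 4] [:: 0; 3; 5]); (1, Within [:: 0; 3; 4] [:: 1; 2; 5]);
       (1, Within [:: 0; 2; 4] [:: 1; 3; 5])])
     (Leaf [:: (1, RowLe 0); (1, RowLe 1); (1, RowLe 3); (1, RowLe 4); (1, RowLe 5); (3, Total);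
       (1, Size); (1, Within [:: 0; 1] [:: 2; 3; 4; 5]); (1, Within [:: 4; 5] [:: 0; 1; 2; 3]);
       (1, Within [:: 0; 3; 5] [:: 1; 2; 4]); (1, Within [:: 0; 3; 4] [:: 1; 2; 5])]))
    (Split [:: 0; 2; 4]
     (Leaf [:: (1, RowLe 0); (2, RowLe 1); (2, RowLe 2); (1, RowLe 3); (2, RowLe 4); (1, RowLe 5);
       (5, Total); (1, Size); (1, Within [:: 0; 1] [:: 2; 3; 4; 5]);
       (1, Within [:: 2; 3] [:: 0; 1; 4; 5]); (1, Within [:: 4; 5] [:: 0; 1; 2; 3]);
       (1, Occ [:: 1; 2; 4]); (2, Within [:: 1; 2; 4] [:: 0; 3; 5]);
       (1, Within [:: 0; 2; 4] [:: 1; 3; 5])])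
     (Leaf [:: (1, RowLe 1); (1, RowLe 2); (1, RowLe 3); (1, RowLe 4); (1, RowLe 5); (3, Total);
       (1, Size); (1, Within [:: 2; 3] [:: 0; 1; 4; 5]); (1, Within [:: 4; 5] [:: 0; 1; 2; 3]);
       (1, Within [:: 1; 2; 4] [:: 0; 3; 5])])))
   (Split [:: 0; 3; 4]
    (Split [:: 0; 2; 4]
     (Leaf [:: (2, RowLe 0); (1, RowLe 1); (1, RowLe 2); (2, RowLe 3); (2, RowLe 4); (1, RowLe 5);
       (5, Total); (1, Size); (1, Within [:: 0; 1] [:: 2; 3; 4; 5]);
       (1, Within [:: 2; 3] [:: 0; 1; 4; 5]); (1, Within [:: 4; 5] [:: 0; 1; 2; 3]);
       (1, Occ [:: 0; 3; 4]); (2, Within [:: 0; 3; 4] [:: 1; 2; 5]);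
       (1, Within [:: 0; 2; 4] [:: 1; 3; 5])])
     (Leaf [:: (1, RowLe 0); (1, RowLe 1); (1, RowLe 3); (1, RowLe 4); (1, RowLe 5); (3, Total);
       (1, Size); (1, Within [:: 0; 1] [:: 2; 3; 4; 5]); (1, Within [:: 4; 5] [:: 0; 1; 2; 3]);
       (1, Within [:: 0; 3; 4] [:: 1; 2; 5])]))
    (Split [:: 1; 3; 5]
     (Leaf [:: (1, RowLe 0); (2, RowLe 1); (1, RowLe 2); (2, RowLe 3); (1, RowLe 4); (2, RowLe 5);
       (5, Total); (1, Size); (1, Within [:: 0; 1] [:: 2; 3; 4; 5]);
       (1, Within [:: 2; 3] [:: 0; 1; 4; 5]); (1, Within [:: 4; 5] [:: 0; 1; 2; 3]);
       (1, Occ [:: 1; 3; 5]); (2, Within [:: 1; 3; 5] [:: 0; 2; 4])])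
     (Parity [:: 0; 2; 4]
      (Leaf [:: (1, RowLe 0); (2, RowLe 1); (1, RowLe 2); (2, RowLe 3); (1, RowLe 4); (2, RowLe 5);
        (5, Total); (1, Within [:: 0; 1] [:: 2; 3; 4; 5]); (1, Within [:: 2; 3] [:: 0; 1; 4; 5]);
        (1, Within [:: 4; 5] [:: 0; 1; 2; 3]); (1, Lo [:: 0; 2; 4])])
      (Leaf [:: (1, RowLe 0); (1, RowLe 2); (1, RowLe 4); (1, Total); (1, Hi [:: 0; 2; 4])])))))
  (Split [:: 1; 2; 5]
   (Split [:: 0; 2; 4]
    (Leaf [:: (1, RowLe 0); (2, RowLe 1); (2, RowLe 2); (1, RowLe 3); (2, RowLe 4); (1, RowLe 5);
      (5, Total); (1, Size); (1, Within [:: 0; 1] [:: 2; 3; 4; 5]); (1, Within [:: 2; 3] [:: 0; 1; 4; 5]);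
      (1, Within [:: 4; 5] [:: 0; 1; 2; 3]); (1, Within [:: 1; 2; 5] [:: 0; 3; 4]);
      (1, Within [:: 0; 2; 4] [:: 1; 3; 5])])
    (Leaf [:: (1, RowLe 1); (1, RowLe 2); (1, RowLe 3); (1, RowLe 4); (1, RowLe 5); (3, Total);
      (1, Size); (1, Within [:: 2; 3] [:: 0; 1; 4; 5]); (1, Within [:: 4; 5] [:: 0; 1; 2; 3]);
      (1, Within [:: 1; 2; 5] [:: 0; 3; 4])]))
   (Split [:: 0; 2; 4]
    (Leaf [:: (1, RowLe 0); (1, RowLe 1); (1, RowLe 2); (1, RowLe 3); (1, RowLe 4); (3, Total);
      (1, Size); (1, Within [:: 0; 1] [:: 2; 3; 4; 5]); (1, Within [:: 2; 3] [:: 0; 1; 4; 5]);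
      (1, Within [:: 0; 2; 4] [:: 1; 3; 5])])
    (Leaf [:: (1, RowLe 0); (2, RowLe 1); (1, RowLe 2); (2, RowLe 3); (2, RowLe 4); (1, RowLe 5);
      (5, Total); (1, Size); (1, Within [:: 0; 1] [:: 2; 3; 4; 5]); (1, Within [:: 2; 3] [:: 0; 1; 4; 5]);
      (1, Within [:: 4; 5] [:: 0; 1; 2; 3])])))).

(** A cherry is two pairs of rows with one row in common, here labelled 0. *)
Lemma cherry_refutationP : refutes cherry_refutation [:: [:: 0; 1]; [:: 0; 2]] [::] [::] [::].
Proof. by vm_compute. Qed.

Lemma matching_refutationP : refutes matching_refutation matching_edges other_edges [::] [::].
Proof. by vm_compute. Qed.

(** * Soundness of the certificate checker *)

Definition pattern {C : finType} (R : C -> {set 'I_6}) (p : seq 'I_6) (c : C) : seq nat :=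
  [seq i <- iota 0 6 | nth ord0 p i \in R c].

Definition eval {C : finType} (pat : C -> seq nat) (q : nat) (F : form) : nat :=
  \sum_c F.1.1 (pat c) + F.1.2 * q + F.2.

Definition holds {C : finType} (pat : C -> seq nat) (q : nat) (a : ineq) : Prop :=
  eval pat q (lhs a) <= eval pat q (rhs a).

Lemma filter_subseqs (P : pred nat) (s : seq nat) : filter P s \in subseqs s.
Proof.
elim: s => //= x s IHs; rewrite mem_cat; case: (P x); last by rewrite IHs orbT.
by rewrite map_f.
Qed.

Lemma eval_combine {C : finType} (pat : C -> seq nat) q side m a cert :
  eval pat q (combine side ((m, a) :: cert)) =
  m * eval pat q (side a) + eval pat q (combine side cert).
Proof.
rewrite /eval /=; case: (side a) => [[w u] v]; case: (combine side cert) => [[w' u'] v'] /=.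
by rewrite big_split /= -big_distrr /=; lia.
Qed.

Lemma combine_holds {C : finType} (pat : C -> seq nat) q cert :
  foldr (fun ma P => holds pat q ma.2 /\ P) True cert ->
  eval pat q (combine lhs cert) <= eval pat q (combine rhs cert).
Proof.
elim: cert => [|[m a] cert IHcert] //= [Ha /IHcert le_cert].
by rewrite !eval_combine leq_add // leq_mul2l Ha orbT.
Qed.

Lemma contradictoryP {C : finType} (pat : C -> seq nat) q zero cert :
  (forall c, pat c \in patterns) -> (forall c, pat c \notin zero) ->
  contradictory zero cert ->
  eval pat q (combine rhs cert) < eval pat q (combine lhs cert).
Proof.
(* Generalising [patterns] keeps simplification from enumerating it. *)
rewrite /contradictory /eval; move: patterns => pats patP zeroP.
case: (combine lhs cert) => [[w u] v]; case: (combine rhs cert) => [[w' u'] v'] /=.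
case/and3P => /allP le_w le_u lt_v.
have : \sum_c w' (pat c) <= \sum_c w (pat c).
  by apply: leq_sum => c _; apply: le_w; rewrite mem_filter zeroP patP.
have le_uq : u' * q <= u * q by rewrite leq_mul2r le_u orbT.
by lia.
Qed.

Lemma mem_pattern {C : finType} (R : C -> {set 'I_6}) p c i : i < 6 ->
  (i \in pattern R p c) = (nth ord0 p i \in R c).
Proof. by move=> lti; rewrite /pattern mem_filter mem_iota leq0n add0n lti !andbT. Qed.

Lemma map_pattern {C : finType} (R : C -> {set 'I_6}) p c : size p = 6 ->
  [seq nth ord0 p i | i <- pattern R p c] = [seq x <- p | x \in R c].
Proof.
move=> p_size; rewrite /pattern -(filter_map (nth ord0 p) (mem (R c))).
have -> : iota 0 6 = iota 0 (size p) by rewrite p_size.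
by rewrite map_nth_iota0 // take_size.
Qed.

Lemma labelling_full (p : seq 'I_6) x : uniq p -> size p = 6 -> x \in p.
Proof.
move=> p_uniq p_size; have eq_card : #|p| = #|'I_6|.
  by rewrite card_ord (card_uniqP p_uniq).
by have /(subset_cardP eq_card) -> := subset_predT (mem p).
Qed.

Lemma mem_rows {C : finType} (R : C -> {set 'I_6}) p c x : uniq p -> size p = 6 ->
  (x \in R c) = (index x p \in pattern R p c).
Proof.
move=> p_uniq p_size; have xp := labelling_full p x p_uniq p_size.
by rewrite mem_pattern ?nth_index //; move: xp; rewrite -index_mem p_size.
Qed.

Lemma size_pattern {C : finType} (R : C -> {set 'I_6}) p c : uniq p -> size p = 6 ->
  size (pattern R p c) = #|R c|.
Proof.
move=> p_uniq p_size.
rewrite -(size_map (nth ord0 p)) map_pattern // -(card_uniqP (filter_uniq _ p_uniq)).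
by apply: eq_card => x; rewrite mem_filter labelling_full // andbT.
Qed.

Lemma pattern_inj {C : finType} (R : C -> {set 'I_6}) p c d : uniq p -> size p = 6 ->
  pattern R p c = pattern R p d -> R c = R d.
Proof.
by move=> p_uniq p_size eq_p; apply/setP => x; rewrite !(mem_rows R p) // eq_p.
Qed.

Lemma pattern_patterns {q : nat} {C : finType} (R : C -> {set 'I_6}) p c :
  profile q C R -> uniq p -> size p = 6 -> pattern R p c \in patterns.
Proof.
move=> RP p_uniq p_size; rewrite /patterns mem_filter filter_subseqs andbT size_pattern //.
exact: profile_gt1 RP.
Qed.

Lemma available_holds {q : nat} {C : finType} (R : C -> {set 'I_6}) p occ lo hi a :
  profile q C R -> uniq p -> size p = 6 ->
  {in occ, forall s, exists c, pattern R p c = s} ->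
  {in lo, forall s, 2 * #|[set c | pattern R p c == s]| + 5 <= q} ->
  {in hi, forall s, q <= 2 * #|[set c | pattern R p c == s]| + 3} ->
  available occ lo hi a -> holds (pattern R p) q a.
Proof.
move=> RP p_uniq p_size occP loP hiP.
have sum0 : \sum_(c : C) 0 = 0 by rewrite big1.
have row i : i < 6 -> \sum_c (i \in pattern R p c : nat) = q.
  move=> lti; rewrite count_sum -(profile_row _ _ _ RP (nth ord0 p i)).
  by apply: eq_card => c; rewrite !inE mem_pattern.
have sum1 : \sum_(c : C) 1 = #|C| by rewrite sum1_card.
rewrite /holds /eval; case: a => [i|i|||e|s W|s|s|s] /=;
  rewrite ?sum0 ?sum1 ?mul0n ?mul1n ?addn0 ?add0n //.
- by move/row ->.
- by move/row ->.
- by rewrite (profile_card _ _ _ RP).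
- by rewrite (profile_size _ _ _ RP).
- move/eqP => size_e; rewrite count_sum.
  (* If no colour has the pattern the count is 0; otherwise some colour has exactly these two
     rows. *)
  have [-> |/set0Pn[c]] := eqVneq [set c | pattern R p c == e] set0; first by rewrite cards0.
  rewrite inE => /eqP pat_c; have Rc : #|R c| = 2 by rewrite -(size_pattern R p) ?pat_c.
  apply: leq_trans (profile_pair c RP Rc); apply/subset_leq_card/subsetP => d.
  by rewrite !inE -pat_c => /eqP /pattern_inj ->.
- case/and3P => /occP[c <-] /allP W_lt /hasPn disjW; rewrite count_sum size_pattern //.
  pose V := [set x in [seq nth ord0 p i | i <- W]].
  have disj : [disjoint R c & V].
    rewrite disjoint_sym; apply/pred0P => x /=; apply/andP => -[].
    rewrite inE => /mapP[i Wi ->]; rewrite -mem_pattern; last exact: W_lt.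
    by apply/negP/disjW.
  have sub : [set d | all (mem W) (pattern R p d)] \subset [set d | R d \subset V].
    apply/subsetP => d; rewrite !inE => /allP sW; apply/subsetP => x.
    rewrite (mem_rows R p) // => /sW Wx; rewrite inE; apply/mapP; exists (index x p) => //.
    by rewrite nth_index // labelling_full.
  apply: leq_trans (subset_leq_card sub) _.
  apply: leq_trans (profile_disjoint _ _ _ RP _ _ disj) _; rewrite leq_mul2l; apply/orP; right.
  by rewrite cardsE (leq_trans (card_size _)) ?size_map.
- by case/occP => c pat_c; rewrite count_sum card_gt0; apply/set0Pn; exists c; rewrite inE pat_c.
- by move/loP; rewrite -big_distrr /= count_sum.
- by move/hiP; rewrite -big_distrr /= count_sum.
Qed.

(** By induction on the tree: the facts at hand always follow one branch of a case distinction, and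
    at the leaf reached they make every inequality of the certificate valid. *)
Lemma refutesP {q : nat} {C : finType} (R : C -> {set 'I_6}) p t occ zero lo hi :
  profile q C R -> odd q -> uniq p -> size p = 6 ->
  {in occ, forall s, exists c, pattern R p c = s} ->
  (forall c, pattern R p c \notin zero) ->
  {in lo, forall s, 2 * #|[set c | pattern R p c == s]| + 5 <= q} ->
  {in hi, forall s, q <= 2 * #|[set c | pattern R p c == s]| + 3} ->
  ~~ refutes t occ zero lo hi.
Proof.
move=> RP q_odd p_uniq p_size.
elim: t occ zero lo hi => [cert|s t1 IH1 t2 IH2|s t1 IH1 t2 IH2] occ zero lo hi occP zeroP loP hiP /=.
- apply/andP => -[cert_ok /(contradictoryP (pattern R p) q)].
  move=> /(_ (fun c => pattern_patterns R p c RP p_uniq p_size) zeroP); apply/negP.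
  rewrite -leqNgt; apply: combine_holds; elim: cert cert_ok => //= ma cert IH /andP[ok_a /IH].
  by split => //; apply: available_holds ok_a.
- have [/existsP[c /eqP pat_c]|/existsPn no_c] := boolP [exists c, pattern R p c == s].
    rewrite (negPf (IH1 _ _ _ _ _ _ _ _)) // => s'; rewrite inE => /orP[/eqP ->|/occP //].
    by exists c.
  by rewrite (negPf (IH2 _ _ _ _ _ _ _ _)) ?andbF // => c; rewrite inE negb_or no_c zeroP.
(* The excluded value [2 * n + 4 = q] is impossible for odd [q]. *)
- have [le5|le3] : 2 * #|[set c | pattern R p c == s]| + 5 <= q \/
                   q <= 2 * #|[set c | pattern R p c == s]| + 3 by lia.
    by rewrite (negPf (IH1 _ _ _ _ _ _ _ _)) // => s'; rewrite inE => /orP[/eqP ->|/loP].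
  by rewrite (negPf (IH2 _ _ _ _ _ _ _ _)) ?andbF // => s'; rewrite inE => /orP[/eqP ->|/hiP].
Qed.

(** * Upper bound *)

(** For a concrete [s] the right side evaluates to a literal pattern, as the certificates
    require. *)
Lemma pattern_set {C : finType} (R : C -> {set 'I_6}) p c s : uniq p -> size p = 6 ->
  all (gtn 6) s -> R c = [set x in [seq nth ord0 p i | i <- s]] ->
  pattern R p c = [seq i <- iota 0 6 | i \in s].
Proof.
move=> p_uniq p_size /allP s_lt Rc; apply: eq_in_filter => i; rewrite mem_iota => /= lti.
rewrite Rc inE; apply/mapP/idP => [[j sj] /eqP|si]; last by exists i.
by rewrite nth_uniq ?p_size //; [move/eqP -> | exact: s_lt].
Qed.

(** The certificates name only the first few labels; the remaining rows may follow in any order. *)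
Lemma extend_labelling (s : seq 'I_6) : uniq s ->
  exists t, uniq (s ++ t) /\ size (s ++ t) = 6.
Proof.
move=> s_uniq; exists [seq x <- enum 'I_6 | x \notin s].
have u : uniq (s ++ [seq x <- enum 'I_6 | x \notin s]).
  rewrite cat_uniq s_uniq filter_uniq ?enum_uniq // andbT /=.
  by apply/hasPn => x; rewrite mem_filter => /andP[].
split=> //; rewrite -(card_uniqP u) -[RHS]card_ord; apply: eq_card => x.
by rewrite mem_cat mem_filter mem_enum !inE andbT orbN.
Qed.

Lemma profile_no_cherry {q : nat} {C : finType} (R : C -> {set 'I_6}) c d :
  profile q C R -> odd q -> #|R c| = 2 -> #|R d| = 2 -> #|R c :&: R d| != 1.
Proof.
move=> RP q_odd Rc Rd; apply/negP => /cards1P[v Rcd].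
have edge e : #|R e| = 2 -> v \in R e -> exists2 w, w != v & R e = [set v; w].
  move/eqP/cards2P => [x [y [neq ->]]]; rewrite !inE => /orP[]/eqP eq_v; subst v.
    by exists y; rewrite // eq_sym.
  by exists x; rewrite // setUC.
have /andP[vc vd] : (v \in R c) && (v \in R d) by rewrite -in_setI Rcd set11.
have [a neq_a Rc'] := edge c Rc vc; have [b neq_b Rd'] := edge d Rd vd.
have neq_ab : a != b.
  apply: contraNneq neq_a => eq_ab; rewrite -in_set1 -Rcd Rc' Rd' eq_ab.
  by rewrite !inE eqxx orbT.
have [t [p_uniq p_size]] : exists t, uniq ([:: v; a; b] ++ t) /\ size ([:: v; a; b] ++ t) = 6.
  apply: extend_labelling; rewrite /= !inE negb_or neq_ab.
  by rewrite (eq_sym v a) (eq_sym v b) neq_a neq_b.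
set p := _ ++ t in p_uniq p_size.
have pat_c : pattern R p c = [:: 0; 1].
  by rewrite (@pattern_set _ R p c [:: 0; 1]) //; apply/setP => x; rewrite Rc' !inE.
have pat_d : pattern R p d = [:: 0; 2].
  by rewrite (@pattern_set _ R p d [:: 0; 2]) //; apply/setP => x; rewrite Rd' !inE.
have := refutesP R p cherry_refutation [:: [:: 0; 1]; [:: 0; 2]] [::] [::] [::].
rewrite cherry_refutationP => /(_ q RP q_odd p_uniq p_size)-H.
suff : ~~ true by [].
by apply: H => // s; rewrite !inE => /orP[]/eqP ->; [exists c | exists d].
Qed.

(** Every colour has at least two rows, so [3 <= #|R c| + (#|R c| == 2)]. Summed over the colours,
    with [6 * q] incidences of rows and colours, this leaves at least 12 pairs. *)
Lemma profile_pairs_ge {q : nat} {C : finType} (R : C -> {set 'I_6}) :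
  profile q C R -> 12 <= #|[set c | #|R c| == 2]|.
Proof.
move=> RP; have leC : 2 * q + 4 <= #|C| := profile_card _ _ _ RP.
have sumR : \sum_c #|R c| = 6 * q.
  transitivity (\sum_c \sum_i (i \in R c : nat)).
    by apply: eq_bigr => c _; rewrite count_sum; apply: eq_card => i; rewrite inE.
  rewrite exchange_big /= (eq_bigr (fun=> q)) ?sum_nat_const ?card_ord // => i _.
  by rewrite count_sum (profile_row _ _ _ RP).
have : \sum_(c : C) 3 <= \sum_c (#|R c| + (#|R c| == 2)).
  by apply: leq_sum => c _; have := profile_gt1 c RP; lia.
have -> : \sum_(c : C) 3 = #|C| * 3 by rewrite sum_nat_const.
have arith m n : 2 * q + 4 <= m -> m * 3 <= 6 * q + n -> 12 <= n by lia.
by rewrite big_split /= sumR count_sum; apply: arith.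
Qed.

Lemma no_profile {q : nat} {C : finType} (R : C -> {set 'I_6}) :
  odd q -> ~ profile q C R.
Proof.
move=> q_odd RP; pose P := [set c | #|R c| == 2]; pose E := R @: P.
have E2 A : A \in E -> #|A| = 2 by case/imsetP => c; rewrite inE => /eqP Rc ->.
have E_triv : trivIset E.
  apply/trivIsetP => A B EA EB neqAB; rewrite -setI_eq0 -cards_eq0.
  case/imsetP: EA neqAB => c; rewrite inE => /eqP Rc ->.
  case/imsetP: EB => d; rewrite inE => /eqP Rd -> neq_cd.
  have := profile_no_cherry R c d RP q_odd Rc Rd.
  (* Distinct pairs do not meet in two rows, nor in one by the absence of cherries, hence they are
     disjoint. *)
  have: #|R c :&: R d| != 2.
    apply: contra_neq neq_cd => I2; apply/eqP; rewrite eqEcard Rc Rd leqnn andbT.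
    by apply/setIidPl/eqP; rewrite eqEcard subsetIl I2 Rc.
  by have := subset_leq_card (subsetIl (R c) (R d)); rewrite Rc; lia.
have coverE : #|cover E| = #|E| * 2.
  by rewrite -(eqP E_triv) (eq_bigr (fun=> 2)) ?sum_nat_const.
have cardP : #|P| <= #|E| * 4.
  rewrite -sum1_card (partition_big R (mem E)) /=; last by move=> c; apply: imset_f.
  rewrite -sum_nat_const; apply: leq_sum => A /imsetP[c]; rewrite inE => /eqP Rc ->.
  apply: leq_trans (profile_pair c RP Rc); rewrite sum1dep_card.
  by apply/subset_leq_card/subsetP => d; rewrite !inE => /andP[].
(* Twelve colours, at most 4 on each pair, need at least three pairs; disjoint pairs among six rows
   number at most three. *)
have cardE3 : #|E| = 3.
  have := profile_pairs_ge R RP; have := max_card (mem (cover E)).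
  by rewrite card_ord coverE -/P; lia.
have [A [B [D [/and3P[nAB nAD nBD] memE]]]] : exists A B D,
    [&& A != B, A != D & B != D] /\ E =i [:: A; B; D].
  have := enum_uniq E; have : enum E =i E by move=> A; rewrite mem_enum.
  have : size (enum E) = 3 by rewrite -cardE cardE3.
  case: (enum E) => [|A [|B [|D []]]] //= _ memE.
  rewrite !inE !andbT negb_or => /andP[/andP[nAB nAD] nBD]; exists A, B, D.
  by rewrite nAB nAD nBD; split => // X; rewrite -memE.
have [EA EB ED] : [/\ A \in E, B \in E & D \in E] by rewrite !memE !inE !eqxx !orbT.
have disj X Y : X \in E -> Y \in E -> X != Y -> forall x y, x \in X -> y \in Y -> x != y.
  move=> EX EY nXY x y Xx Yy; apply: contraTneq Xx => ->.
  by rewrite (disjointFl (trivIsetP E_triv _ _ EX EY nXY)).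
have /eqP/cards2P[a [a' [nA defA]]] := E2 _ EA.
have /eqP/cards2P[b [b' [nB defB]]] := E2 _ EB.
have /eqP/cards2P[d [d' [nD defD]]] := E2 _ ED.
(* In this labelling the three pairs become the patterns in [matching_edges]. *)
pose p := [:: a; a'; b; b'; d; d'].
have p_uniq : uniq p.
  rewrite /= !inE !negb_or nA nB nD /= !andbT.
  by do ![apply/andP; split]; first
    [ by apply: (disj A B) => //; rewrite (defA, defB) !inE eqxx ?orbT
    | by apply: (disj A D) => //; rewrite (defA, defD) !inE eqxx ?orbT
    | by apply: (disj B D) => //; rewrite (defB, defD) !inE eqxx ?orbT].
have p_size : size p = 6 by [].
have patA c : R c = A -> pattern R p c = [:: 0; 1].
  by move=> Rc; rewrite (@pattern_set _ R p c [:: 0; 1]) // Rc defA; apply/setP => x; rewrite !inE.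
have patB c : R c = B -> pattern R p c = [:: 2; 3].
  by move=> Rc; rewrite (@pattern_set _ R p c [:: 2; 3]) // Rc defB; apply/setP => x; rewrite !inE.
have patD c : R c = D -> pattern R p c = [:: 4; 5].
  by move=> Rc; rewrite (@pattern_set _ R p c [:: 4; 5]) // Rc defD; apply/setP => x; rewrite !inE.
have := refutesP R p matching_refutation matching_edges other_edges [::] [::].
rewrite matching_refutationP => /(_ q RP q_odd p_uniq p_size)-H.
suff : ~~ true by [].
apply: H => // [s|c].
  rewrite !inE => /or3P[] /eqP ->.
  - by have /imsetP[c _ Rc] := EA; exists c; apply: patA.
  - by have /imsetP[c _ Rc] := EB; exists c; apply: patB.
  - by have /imsetP[c _ Rc] := ED; exists c; apply: patD.
(* A colour with two rows has its row set in [E], so its pattern cannot lie in [other_edges]. *)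
rewrite mem_filter; apply/negP => /andP[/andP[]].
rewrite size_pattern // => Rc not_matching _.
have : R c \in E by apply: imset_f; rewrite inE.
rewrite memE !inE; apply/negP; apply: contra not_matching.
by case/or3P => /eqP; [move/patA | move/patB | move/patD] => ->.
Qed.

Theorem theorem2 (q : nat) (hq : 41 <= q) (hodd : odd q) :
  achromatic_number_is (cart_prod (Kn 6) (Kn q)) (2 * q + 3).
Proof.
split=> [|k [f [f_proper f_complete]]].
  by apply: complete_coloring_exists => //; apply: leq_trans hq.
rewrite leqNgt; apply/negP => lt_k.
have k_ge : 2 * q + 4 <= k by lia.
exact: no_profile hodd (coloring_profile f hq k_ge f_proper f_complete).
Qed.
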